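(* For every positive integer $n$, the family of $(2K_2,P_4\vee K_n)$-free graphs is near optimal colourable.
   Context: All graphs are finite and simple. $P_n$ and $K_n$ denote the path and the complete graph on $n$ vertices; $2K_2$ is the disjoint union of two copies of $K_2$; $G\vee H$ is obtained from the disjoint union of $G$ and $H$ by adding an edge between every vertex of $G$ and every vertex of $H$. A graph is $(H_1,H_2)$-free if it has no induced subgraph isomorphic to $H_1$ or to $H_2$. $\chi(G)$ is the chromatic number and $\omega(G)$ the clique number of $G$. A graph family $\mathcal{G}$ is near optimal colourable if there is a constant number $c$ such that every $G\in\mathcal{G}$ satisfies $\chi(G)\leq\max\{c,\omega(G)\}$. *)

(* Defs.v *)
From HB Require Import structures.
From mathcomp Require Import all_boot.

Set Implicit Arguments.
Unset Strict Implicit.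
Unset Printing Implicit Defensive.

(* Finite simple graphs; the graph with no vertices is allowed. *)
Record sgraph := SGraph {
  vertex :> finType;
  edge : rel vertex;
  edge_sym : symmetric edge;
  edge_irrefl : irreflexive edge }.

Definition giso (G H : sgraph) : Prop :=
  exists2 f : G -> H, bijective f & forall x y, edge (f x) (f y) = edge x y.

Section Induced.
Variables (G : sgraph) (A : {set G}).

Definition induced_rel : rel {x : G | x \in A} :=
  fun x y => edge (val x) (val y).

Lemma induced_sym : symmetric induced_rel.
Proof. by move=> x y; apply: edge_sym. Qed.

Lemma induced_irrefl : irreflexive induced_rel.
Proof. by move=> x; apply: edge_irrefl. Qed.

Definition induced : sgraph := SGraph induced_sym induced_irrefl.
End Induced.

Definition has_induced (G H : sgraph) : Prop :=
  exists A : {set G}, giso (induced A) H.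

Definition free2 (H1 H2 G : sgraph) : Prop :=
  ~ has_induced G H1 /\ ~ has_induced G H2.

Section Path.
Variable n : nat.

Definition path_rel : rel 'I_n :=
  fun i j => (i.+1 == j :> nat) || (j.+1 == i :> nat).

Lemma path_sym : symmetric path_rel.
Proof. by move=> i j; apply: orbC. Qed.

Lemma path_irrefl : irreflexive path_rel.
Proof. by move=> i; rewrite /path_rel orbb gtn_eqF. Qed.

Definition path_graph : sgraph := SGraph path_sym path_irrefl.
End Path.

Section Complete.
Variable n : nat.

Definition complete_rel : rel 'I_n := fun i j => i != j.

Lemma complete_sym : symmetric complete_rel.
Proof. by move=> i j; rewrite /complete_rel eq_sym. Qed.

Lemma complete_irrefl : irreflexive complete_rel.
Proof. by move=> i; rewrite /complete_rel eqxx. Qed.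

Definition complete_graph : sgraph := SGraph complete_sym complete_irrefl.
End Complete.

Section UnionJoin.
Variables G H : sgraph.

(* [b] says whether vertices of [G] are adjacent to vertices of [H]. *)
Definition sum_rel (b : bool) : rel (G + H)%type := fun u v =>
  match u, v with
  | inl x, inl y => edge x y
  | inr x, inr y => edge x y
  | _, _ => b
  end.

Lemma sum_rel_sym b : symmetric (sum_rel b).
Proof. by move=> [x|x] [y|y] //=; apply: edge_sym. Qed.

Lemma sum_rel_irrefl b : irreflexive (sum_rel b).
Proof. by move=> [x|x] /=; apply: edge_irrefl. Qed.

Definition disjoint_union : sgraph :=
  SGraph (sum_rel_sym false) (sum_rel_irrefl false).

Definition join : sgraph := SGraph (sum_rel_sym true) (sum_rel_irrefl true).
End UnionJoin.

Definition two_K2 : sgraph :=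
  disjoint_union (complete_graph 2) (complete_graph 2).

Definition colorable (G : sgraph) (k : nat) : bool :=
  [exists f : {ffun G -> 'I_k},
    [forall x, forall y, edge x y ==> (f x != f y)]].

Lemma colorable_card (G : sgraph) : exists k, colorable G k.
Proof.
exists #|G|; apply/existsP; exists [ffun x => enum_rank x].
apply/forallP => x; apply/forallP => y; apply/implyP => xy.
rewrite !ffunE (inj_eq enum_rank_inj); apply: contraTneq xy => ->.
by rewrite edge_irrefl.
Qed.

Definition chi (G : sgraph) : nat := ex_minn (colorable_card G).

Definition clique (G : sgraph) (A : {set G}) : bool :=
  [forall x in A, forall y in A, (x != y) ==> edge x y].

Definition omega (G : sgraph) : nat := \max_(A : {set G} | clique A) #|A|.

Definition near_optimal_colourable (F : sgraph -> Prop) : Prop :=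
  exists c : nat, forall G : sgraph, F G -> chi G <= maxn c (omega G).

(* Main.v *)
Require Import Defs.
From mathcomp Require Import all_boot.
From mathcomp Require Import zify.

(** The theorem holds because a maximum clique K can serve as a palette: every
    vertex u is given a colour in [miss u], the set of members of K that u is
    not adjacent to. By maximality of K this set is never empty, and for u in
    K it is the singleton of u, so the vertices of K need no separate
    treatment. A colouring of this kind uses #|K| colours.

    Three local facts control conflicts. If u and v are adjacent, [miss u] and
    [miss v] share at most one vertex, as two shared vertices x, y would make
    uv and xy an induced 2K_2 ([card_missI]). If u and v are not adjacent and
    x, y in K witness that [miss u] and [miss v] are incomparable, then v, x,
    y, u is an induced P_4; if u and v are adjacent, share a missed vertex x,
    and u misses some other y, then u, v, y, x is an induced P_4. Either path
    is complete to K minus [miss u] and [miss v], so this remainder has fewer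
    than n vertices ([miss_nested], [overlap_room]).

    Call u small if 2 #|miss u| + n <= #|K|. For two small vertices the
    remainder has at least n vertices, so adjacent ones have disjoint sets and
    nonadjacent ones have nested sets; every choice of [miss_elt u] in
    [miss u] is then proper on the small vertices. For a large vertex u, keep
    the colours [avail u] of [miss u] that no small neighbour uses. If none
    were left, the neighbours blocking the colours of [miss u] would form,
    with u and the rest of K, a clique larger than K ([avail_neq0]).

    It remains to separate the large vertices from each other when #|K| is
    much larger than n. If two large vertices are adjacent, their missed sets
    almost split K into halves, and each of them loses at most one colour to
    its small neighbours ([card_blocked]). Fix such an edge ab. As the graph
    is 2K_2-free, every other edge between large vertices meets ab or is joined
    to it by an edge, which forces one endpoint to miss nearly what b misses and the
    other to miss little of it ([near_two_sided]); the first kind takes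
    colours inside [miss b], the second kind outside.

    When #|K| is bounded in terms of n, the quadratic bound of Wagon for
    2K_2-free graphs, [chi_le_square], provides the constant. *)

Set Implicit Arguments.
Unset Strict Implicit.
Unset Printing Implicit Defensive.

(** * Induced subgraphs, cliques and colourings *)

Lemma has_induced_inj (G H : sgraph) (g : H -> G) :
  injective g -> (forall x y, edge (g x) (g y) = edge x y) -> has_induced G H.
Proof.
move=> g_inj g_edge; pose A := [set g h | h in H]; exists A.
have gA h : g h \in A by apply: imset_f.
pose g' h : {x | x \in A} := exist _ (g h) (gA h).
have g'_inj : injective g' by move=> h1 h2 [] /g_inj.
have [f g'K fK] : bijective g'.
  by apply: inj_card_bij => //; rewrite card_sig card_imset.
exists f; first by exists g'.
by move=> x y; rewrite -g_edge -{2}[x]fK -{2}[y]fK.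
Qed.

Lemma cliqueP (G : sgraph) (A : {set G}) :
  reflect {in A &, forall x y, x != y -> edge x y} (clique A).
Proof.
apply: (iffP forall_inP) => [H x y xA yA xy | H x xA].
  by have /forall_inP/(_ y yA)/implyP := H x xA; apply.
by apply/forall_inP => y yA; apply/implyP; apply: H.
Qed.

Lemma clique_subset (G : sgraph) (A B : {set G}) :
  A \subset B -> clique B -> clique A.
Proof.
move=> /subsetP AB /cliqueP H.
by apply/cliqueP => x y /AB xB /AB; apply: H.
Qed.

(** The distinctness of the four vertices follows from the adjacencies, because
    no two vertices of 2K_2 have the same neighbours; this spares the users of
    the lemma any inequality. The same holds in [no_P4_join]. *)
Lemma no_two_K2 (G : sgraph) (u v x y : G) :
    ~ has_induced G two_K2 -> edge u v -> edge x y ->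
    ~~ edge u x -> ~~ edge u y -> ~~ edge v x -> ~~ edge v y -> False.
Proof.
move=> noH uv xy ux uy vx vy; apply: noH.
have sy := @edge_sym G.
have [vu yx] : edge v u /\ edge y x by rewrite sy uv sy xy.
have [xu yu xv yv] : [/\ ~~ edge x u, ~~ edge y u, ~~ edge x v & ~~ edge y v].
  by rewrite ![edge x _]sy ![edge y _]sy.
pose g (w : two_K2) : G := match w with
  | inl i => if i == ord0 then u else v
  | inr i => if i == ord0 then x else y end.
have g_edge w1 w2 : edge (g w1) (g w2) = edge w1 w2.
  case: w1 w2 => [[[|[|//]] ?]|[[|[|//]] ?]] [[[|[|//]] ?]|[[|[|//]] ?]];
    by rewrite /g /= /complete_rel -?val_eqE /= ?edge_irrefl //;
       do ?[exact/negbTE | exact/idP].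
apply: (has_induced_inj (g := g)) => // w1 w2 eqg.
have E w : edge w1 w = edge w2 w by rewrite -!g_edge eqg.
case: w1 w2 E {eqg} => [i|i] [j|j] E.
- by have := E (inl i); rewrite /= /complete_rel eqxx => /esym/negbFE/eqP->.
- have := E (inl (if i == ord0 then ord_max else ord0)).
  by rewrite /= /complete_rel; case: i {E} => [[|[|//]] ?].
- have := E (inr (if i == ord0 then ord_max else ord0)).
  by rewrite /= /complete_rel; case: i {E} => [[|[|//]] ?].
- by have := E (inr i); rewrite /= /complete_rel eqxx => /esym/negbFE/eqP->.
Qed.

Lemma no_P4_join (G : sgraph) (n : nat) (p q r s : G) (Q : {set G}) :
    ~ has_induced G (join (path_graph 4) (complete_graph n)) ->
    edge p q -> edge q r -> edge r s ->
    ~~ edge p r -> ~~ edge p s -> ~~ edge q s ->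
    clique Q ->
    {in Q, forall z, [/\ edge p z, edge q z, edge r z & edge s z]} ->
  #|Q| < n.
Proof.
move=> noH pq qr rs pr ps qs /cliqueP clQ adjQ.
rewrite ltnNge; apply: contra_notN noH => leQ.
have sy := @edge_sym G.
pose t := [tuple p; q; r; s].
pose e (i : 'I_n) : G := enum_val (widen_ord leQ i).
have eQ i : e i \in Q by apply: enum_valP.
have e_edge i j : edge (e i) (e j) = (i != j).
  case: eqVneq => [->|ij]; first by rewrite edge_irrefl.
  apply: clQ => //.
  by apply: contraNneq ij => /enum_val_inj/(congr1 val)/= /val_inj->.
pose g (w : join (path_graph 4) (complete_graph n)) : G := match w with
  | inl i => tnth t i | inr j => e j end.
have te i j : edge (tnth t i) (e j).
  have [? ? ? ?] := adjQ _ (eQ j).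
  by rewrite (tnth_nth p); case: i => [[|[|[|[|//]]]] ?].
have g_edge w1 w2 : edge (g w1) (g w2) = edge w1 w2.
  case: w1 w2 => [i|i] [j|j] /=; rewrite ?e_edge ?te //; last by rewrite sy te.
  rewrite !(tnth_nth p) /path_rel.
  case: i j => [[|[|[|[|//]]]] ?] [[|[|[|[|//]]]] ?] /=;
    rewrite ?edge_irrefl //;
    do ?[by apply/idP | by apply/negbTE | by rewrite sy; apply/idP
       | by rewrite sy; apply/negbTE].
apply: (has_induced_inj (g := g)) => // w1 w2 eqg.
have E w : edge w1 w = edge w2 w by rewrite -!g_edge eqg.
case: w1 w2 E {eqg} => [i|i] [j|j] E.
- have := (E (inl ord0), E (inl ord_max), E (inl (inord 1)), E (inl (inord 2))).
  rewrite /= /path_rel /= !inordK //.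
  case: i j {E} => [[|[|[|[|//]]]] ?] [[|[|[|[|//]]]] ?] /= [[[]]] //= _ _ _ _;
    by congr inl; apply: val_inj.
- by have := E (inr j); rewrite /= /complete_rel eqxx.
- by have := E (inr i); rewrite /= /complete_rel eqxx.
- by have := E (inr i); rewrite /= /complete_rel eqxx => /esym/negbFE/eqP->.
Qed.

Lemma chi_le_card (G : sgraph) (T : finType) (D : {set T}) (c : G -> T) :
    (forall u, c u \in D) -> (forall u v, edge u v -> c u != c v) ->
  chi G <= #|D|.
Proof.
move=> cD c_proper; rewrite /chi; case: ex_minnP => m _; apply.
apply/existsP; exists [ffun u => enum_rank_in (cD u) (c u)].
apply/'forall_forallP => u v; apply/implyP => /c_proper; rewrite !ffunE.
by apply: contra => /eqP/(congr1 enum_val); rewrite !enum_rankK_in // => ->.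
Qed.

(** * Vertices missed in a maximum clique *)

Section MaximumClique.
Variables (G : sgraph) (n : nat) (K : {set G}).
Hypothesis no2K2 : ~ has_induced G two_K2.
Hypothesis noP4K : ~ has_induced G (join (path_graph 4) (complete_graph n)).
Hypothesis K_clique : clique K.
Hypothesis K_max : forall A : {set G}, clique A -> #|A| <= #|K|.

Definition miss (u : G) : {set G} := [set x in K | ~~ edge u x].

Lemma missP u x : reflect (x \in K /\ ~~ edge u x) (x \in miss u).
Proof. by rewrite inE; apply: andP. Qed.

Lemma miss_sub u : miss u \subset K.
Proof. by apply/subsetP => x /missP[]. Qed.

Lemma miss_in u : u \in K -> miss u = [set u].
Proof.
move=> uK; apply/setP => x; rewrite !inE; case: eqVneq => [->|xu].
  by rewrite uK edge_irrefl.
by case xK: (x \in K) => //=; rewrite (cliqueP _ K_clique) // eq_sym.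
Qed.

Lemma edge_notin_miss u x : x \in K -> x \notin miss u -> edge u x.
Proof. by move=> xK; rewrite inE xK negbK. Qed.

Lemma card_missI u v : edge u v -> #|miss u :&: miss v| <= 1.
Proof.
move=> uv; rewrite leqNgt; apply/negP => /card_gt1P[x [y []]].
move=> /setIP[/missP[xK ux] /missP[_ vx]] /setIP[/missP[yK uy] /missP[_ vy]] xy.
by apply: (no_two_K2 no2K2 uv _ ux uy vx vy); apply: (cliqueP _ K_clique).
Qed.

Lemma miss_nested u v : ~~ edge u v -> n <= #|K :\: (miss u :|: miss v)| ->
  (miss u \subset miss v) || (miss v \subset miss u).
Proof.
move=> uv; apply: contraLR; rewrite negb_or -ltnNge.
move=> /andP[/subsetPn[x xu xv] /subsetPn[y yv yu]].
have [xK ux] := missP _ _ xu; have [yK vy] := missP _ _ yv.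
have vx := edge_notin_miss xK xv; have uy := edge_notin_miss yK yu.
have xy : x != y by apply: contraNneq xv => ->.
apply: (@no_P4_join G n v x y u) => //.
- exact: (cliqueP _ K_clique).
- by rewrite edge_sym.
- by rewrite edge_sym.
- by rewrite edge_sym.
- exact: clique_subset (subsetDl _ _) K_clique.
move=> z /setDP[zK]; rewrite in_setU negb_or => /andP[zu zv].
have xz : x != z by apply: contraNneq zu => <-.
have yz : y != z by apply: contraNneq zv => <-.
by split; do ?[exact: edge_notin_miss | exact: (cliqueP _ K_clique)].
Qed.

Lemma overlap_room u v x :
    edge u v -> x \in miss u -> x \in miss v -> 1 < #|miss u| ->
  #|K :\: (miss u :|: miss v)| < n.
Proof.
move=> uv xu xv u2.
have [y] : exists y, y \in miss u :\ x.
  by apply/set0Pn; rewrite -card_gt0; move: u2; rewrite (cardsD1 x) xu.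
case/setD1P => yx yu.
have [xK ux] := missP _ _ xu; have [_ vx] := missP _ _ xv.
have [yK uy] := missP _ _ yu.
have yv : y \notin miss v.
  apply/negP => yv; have := card_missI uv; apply/negP; rewrite -ltnNge.
  apply/card_gt1P; exists x, y.
  by split; rewrite ?in_setI ?xu ?xv ?yu ?yv // eq_sym.
apply: (@no_P4_join G n u v y x) => //.
- exact: edge_notin_miss.
- exact: (cliqueP _ K_clique).
- exact: clique_subset (subsetDl _ _) K_clique.
move=> z /setDP[zK]; rewrite in_setU negb_or => /andP[zu zv].
have xz : x != z by apply: contraNneq zu => <-.
have yz : y != z by apply: contraNneq zu => <-.
by split; do ?[exact: edge_notin_miss | exact: (cliqueP _ K_clique)].
Qed.

(** Every use of the maximality of K goes through this exchange: replacing
    [miss u] in K by its image under [g] and adding u yields a clique with one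
    vertex more than K. *)
Lemma no_clique_swap u (g : G -> G) :
    {in miss u, forall x, edge u (g x) /\ miss (g x) = [set x]} ->
    {in miss u &, forall x y, x != y -> edge (g x) (g y)} -> False.
Proof.
move=> gP g_edge; pose A := u |: (g @: miss u :|: (K :\: miss u)).
have g_inj : {in miss u &, injective g}.
  move=> x y xu yu exy; apply: set1_inj.
  by have [_ <-] := gP _ xu; have [_ <-] := gP _ yu; rewrite exy.
have /K_max : clique A.
  have gz x z : x \in miss u -> z \in K :\: miss u -> edge (g x) z.
    move=> xu /setDP[zK zu]; have [_ mg] := gP _ xu.
    by apply: edge_notin_miss => //; rewrite mg inE; apply: contraNneq zu => ->.
  have uz z : z \in K :\: miss u -> edge u z.
    by move=> /setDP[zK zu]; apply: edge_notin_miss.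
  have sy := @edge_sym G.
  apply/cliqueP => a b /setU1P[->|/setUP[/imsetP[x xu ->]|aK]];
     move=> /setU1P[->|/setUP[/imsetP[y yu ->]|bK]] ab.
  - by rewrite eqxx in ab.
  - by case: (gP _ yu).
  - exact: uz.
  - by rewrite sy; case: (gP _ xu).
  - by apply: g_edge => //; apply: contraNneq ab => ->.
  - exact: gz.
  - by rewrite sy uz.
  - by rewrite sy gz.
  - by apply: (cliqueP _ K_clique) => //; [case/setDP: aK | case/setDP: bK].
apply/negP; rewrite -ltnNge /A cardsU1.
have -> : u \notin g @: miss u :|: K :\: miss u.
  apply/negP => /setUP[/imsetP[x xu eu]|/setDP[uK]]; last first.
    by rewrite miss_in // set11.
  by have [] := gP _ xu; rewrite -eu edge_irrefl.
rewrite cardsU card_in_imset //.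
have -> : g @: miss u :&: (K :\: miss u) = set0.
  apply/setP => z; rewrite in_set0; apply/negP.
  move=> /setIP[/imsetP[x xu ->] /setDP[gK]]; have [_ mg] := gP _ xu.
  by move: mg; rewrite miss_in // => /set1_inj ->; rewrite xu.
rewrite cards0 cardsD (setIidPr (miss_sub u)).
by have := subset_leq_card (miss_sub u); lia.
Qed.

Lemma no_twin_edge u v x :
  edge u v -> miss u = [set x] -> miss v = [set x] -> False.
Proof.
move=> uv mu mv; apply: (@no_clique_swap u (fun=> v)); rewrite mu.
  by move=> _ /set1P->.
by move=> _ _ /set1P-> /set1P->; rewrite eqxx.
Qed.

Lemma miss_neq0 u : miss u != set0.
Proof.
apply/negP => /eqP mu.
by apply: (@no_clique_swap u id); rewrite mu => x; rewrite inE.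
Qed.

Definition miss_elt u := odflt u [pick x in miss u].

Lemma miss_eltP u : miss_elt u \in miss u.
Proof.
rewrite /miss_elt; case: pickP => //= mu.
by have /set0Pn[x] := miss_neq0 u; rewrite mu.
Qed.

(** Colour u by a pair of vertices that it misses, distinct whenever possible.
    Adjacent vertices with the same colour would share two missed vertices, or
    both miss the same single vertex. *)
Lemma chi_le_square : chi G <= #|K| * #|K|.
Proof.
rewrite -cardsX.
pose snd_elt u := odflt (miss_elt u) [pick x in miss u :\ miss_elt u].
have sndP u : snd_elt u \in miss u.
  rewrite /snd_elt; case: pickP => [x /setD1P[]|] //= _; exact: miss_eltP.
have snd1 u : snd_elt u = miss_elt u -> miss u = [set miss_elt u].
  rewrite /snd_elt; case: pickP => [x /setD1P[/eqP]|] //= mu _.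
  apply/eqP; rewrite eqEsubset sub1set miss_eltP andbT -setD_eq0.
  by apply/eqP/setP => x; rewrite mu inE.
apply: (@chi_le_card _ _ _ (fun u => (miss_elt u, snd_elt u))) => [u|u v uv].
  by rewrite inE /= !(subsetP (miss_sub u)) ?miss_eltP.
apply/eqP => -[e1 e2]; have [e|ne] := eqVneq (snd_elt u) (miss_elt u).
  apply: (no_twin_edge uv (snd1 _ e)); rewrite e1; apply: snd1.
  by rewrite -e2 -e1.
have := card_missI uv; apply/negP; rewrite -ltnNge; apply/card_gt1P.
exists (snd_elt u), (miss_elt u); split=> //; rewrite inE.
  by rewrite sndP e2 sndP.
by rewrite miss_eltP e1 miss_eltP.
Qed.

(** * Small vertices *)

Definition small u := 2 * #|miss u| + n <= #|K|.

Lemma card_room u v :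
  #|K :\: (miss u :|: miss v)| + #|miss u :|: miss v| = #|K|.
Proof.
have sub : miss u :|: miss v \subset K by rewrite subUset !miss_sub.
by rewrite cardsDS // subnK // subset_leq_card.
Qed.

Lemma small_room u v : small u -> small v -> n <= #|K :\: (miss u :|: miss v)|.
Proof.
rewrite /small => su sv.
have [+ _] := leq_card_setU (miss u) (miss v); have := card_room u v; lia.
Qed.

(** A shared x would be the only vertex missed by either end, since otherwise
    [overlap_room] contradicts [small_room]; then u and v could replace x. *)
Lemma small_edge_disjoint u v x :
  small u -> small v -> edge u v -> x \in miss u -> x \notin miss v.
Proof.
move=> su sv uv xu; apply/negP => xv.
have single w w' : small w -> small w' -> edge w w' ->
    x \in miss w -> x \in miss w' -> miss w = [set x].
  move=> sw sw' ww' xw xw'; apply/eqP; rewrite eq_sym eqEcard sub1set xw cards1.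
  rewrite leqNgt; apply/negP => w2.
  by have := overlap_room ww' xw xw' w2; rewrite ltnNge small_room.
apply: (no_twin_edge uv); first exact: (single u v).
by apply: (single v u); rewrite // edge_sym.
Qed.

(** * Colours left for a large vertex *)

Definition blocked u x :=
  [exists v, [&& small v, edge u v & miss_elt v == x]].
Definition avail u := [set x in miss u | ~~ blocked u x].

Lemma blockedP u x :
  reflect (exists v, [/\ small v, edge u v & miss_elt v = x]) (blocked u x).
Proof.
apply: (iffP existsP) => -[v].
  by case/and3P => ? ? /eqP; exists v.
by case=> ? ? /eqP ?; exists v; apply/and3P.
Qed.

Lemma blocker_missI u v :
  edge u v -> miss_elt v \in miss u -> miss u :&: miss v = [set miss_elt v].
Proof.
move=> uv vu; apply/esym/eqP.
by rewrite eqEcard sub1set inE vu miss_eltP cards1 card_missI.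
Qed.

(** If v and w were not adjacent, their missed sets would be nested, and the
    larger one would share both chosen colours with [miss u], although adjacent
    vertices share at most one missed vertex. *)
Lemma blockers_adjacent u v w :
    small v -> edge u v -> miss_elt v \in miss u ->
    small w -> edge u w -> miss_elt w \in miss u ->
  miss_elt v != miss_elt w -> edge v w.
Proof.
move=> sv uv vu sw uw wu; apply: contraR => nvw.
have H a b : edge u b -> miss_elt b \in miss u -> miss_elt a \in miss u ->
    miss a \subset miss b -> miss_elt a = miss_elt b.
  move=> ub bu au ab; apply/set1P; rewrite -(blocker_missI ub bu) inE au.
  exact: (subsetP ab) (miss_eltP a).
have /orP[ab|ba] := miss_nested nvw (small_room sv sw).
  exact/eqP/(H v w).
exact/eqP/esym/(H w v).
Qed.

(** If each x in [miss u] is blocked by a small neighbour [g x] of u, these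
    neighbours are pairwise adjacent. None of them misses a second vertex y:
    otherwise [g x], u, y, x is an induced P_4, complete to the
    clique of the [g a] with a distinct from x, of size at least n. So [g x] misses x only, and
    [no_clique_swap] applies. *)
Lemma avail_neq0 u : n < #|miss u| -> avail u != set0.
Proof.
move=> un; apply/negP => /eqP av0.
have bl x : x \in miss u -> blocked u x.
  move=> xu; apply/negbNE/negP => nb.
  by have := in_set0 x; rewrite -av0 inE xu nb.
pose g x := odflt u [pick v | [&& small v, edge u v & miss_elt v == x]].
have gP x : x \in miss u -> [/\ small (g x), edge u (g x) & miss_elt (g x) = x].
  move=> /bl/existsP[v vP]; rewrite /g; case: pickP => [w /and3P[? ? /eqP]//|].
  by move/(_ v); rewrite vP.
have gg x y : x \in miss u -> y \in miss u -> x != y -> edge (g x) (g y).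
  move=> xu yu xy; have [sx ux ex] := gP _ xu; have [sy uy ey] := gP _ yu.
  by apply: (blockers_adjacent (u := u)); rewrite ?ex ?ey.
apply: (@no_clique_swap u g) => // x xu; have [sx ux ex] := gP _ xu; split=> //.
have xg : x \in miss (g x) by rewrite -{1}ex miss_eltP.
apply/eqP; rewrite eqEsubset sub1set xg andbT; apply/subsetP => y yg.
rewrite inE; apply/negP => /negP yx.
have [yK gy] := missP _ _ yg; have [xK gx] := missP _ _ xg.
have [_ nux] := missP _ _ xu.
have yu : y \notin miss u.
  apply: contra yx => yu; have := blocker_missI ux.
  by rewrite ex => /(_ xu) E; rewrite -in_set1 -E inE yu.
(* The clique joined to the path lies outside K here. *)
have : #|g @: (miss u :\ x)| < n.
  apply: (@no_P4_join G n (g x) u y x) => //.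
  - by rewrite edge_sym.
  - exact: edge_notin_miss.
  - exact: (cliqueP _ K_clique).
  - apply/cliqueP => _ + /imsetP[a /setD1P[_ au] ->].
    move=> _ /imsetP[b /setD1P[_ bu] ->] ab.
    by apply: gg => //; apply: contraNneq ab => ->.
  move=> _ /imsetP[a /setD1P[ax au] ->]; have [sa ua ea] := gP _ au.
  have xa : edge (g x) (g a) by apply: gg => //; rewrite eq_sym.
  split=> //; rewrite edge_sym; apply: edge_notin_miss => //;
    exact: (small_edge_disjoint sx sa xa).
rewrite card_in_imset => [|a b /setD1P[_ au] /setD1P[_ bu] eab].
  by move: un; rewrite (cardsD1 x (miss u)) xu; lia.
by have [_ _ <-] := gP _ au; have [_ _ <-] := gP _ bu; rewrite eab.
Qed.

(** A blocker v of a colour of [miss u] must, by [overlap_room], miss all but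
    fewer than n vertices of K outside [miss u]. Blockers of two colours are
    adjacent, hence miss disjoint sets, which leaves no place for both. *)
Lemma card_blocked u :
  1 < #|miss u| -> 2 * n <= #|K :\: miss u| -> #|miss u :\: avail u| <= 1.
Proof.
move=> u2 room; rewrite leqNgt; apply/negP => /card_gt1P[x [y []]].
have blk z : z \in miss u :\: avail u -> z \in miss u /\ blocked u z.
  by case/setDP => zu; rewrite inE zu negbK.
move=> /blk[xu /blockedP[v [sv uv ev]]] /blk[yu /blockedP[w [sw uw ew]]] xy.
have vw : edge v w by apply: (blockers_adjacent (u := u)); rewrite ?ev ?ew.
have rv := overlap_room uv xu _ u2; have rw := overlap_room uw yu _ u2.
have {}rv : #|(K :\: miss u) :\: miss v| < n.
  by rewrite setDDl rv // -ev miss_eltP.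
have {}rw : #|(K :\: miss u) :\: miss w| < n.
  by rewrite setDDl rw // -ew miss_eltP.
pose rest z := (K :\: miss u) :\: miss z.
have : K :\: miss u \subset rest v :|: rest w.
  apply/subsetP => z zK; rewrite in_setU !(in_setD (K :\: miss u)) zK !andbT.
  case zv: (z \in miss v) => //=.
  exact: (small_edge_disjoint sv sw vw zv).
move=> /subset_leq_card; rewrite /rest => le.
have [+ _] := leq_card_setU (rest v) (rest w); rewrite /rest; lia.
Qed.

(** * Colouring the large vertices *)

Lemma large_card u : ~~ small u -> #|K| < 2 * #|miss u| + n.
Proof. by rewrite -ltnNge. Qed.

Lemma card_miss_edge u v : edge u v -> #|miss u| + #|miss v| <= #|K| + 1.
Proof.
move=> uv; rewrite -cardsUI leq_add ?card_missI // subset_leq_card //.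
by rewrite subUset !miss_sub.
Qed.

(* Any lower bound that suffices for the linear estimates below would do. *)
Hypothesis K_large : 10 * n + 20 <= #|K|.

Lemma small_miss_elt_proper u v :
  small u -> small v -> edge u v -> miss_elt u != miss_elt v.
Proof.
move=> su sv uv; have := small_edge_disjoint su sv uv (miss_eltP u).
by apply: contraNneq => ->; apply: miss_eltP.
Qed.

Lemma avail_meets u v (B : {set G}) :
    ~~ small u -> ~~ small v -> edge u v -> 1 < #|miss u :&: B| ->
  exists2 x, x \in avail u & x \in B.
Proof.
move=> /large_card lu /large_card lv uv B2.
have room : #|K :\: miss u| = #|K| - #|miss u| by rewrite cardsDS ?miss_sub.
have le1 : #|miss u :\: avail u| <= 1.
  by apply: card_blocked; rewrite ?room; have := card_miss_edge uv; lia.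
have /subset_leq_card :
    miss u :&: B \subset (avail u :&: B) :|: (miss u :\: avail u).
  apply/subsetP => x /setIP[xu xB].
  rewrite in_setU in_setI in_setD xu xB !andbT.
  by case: (x \in avail u).
have [+ _] := leq_card_setU (avail u :&: B) (miss u :\: avail u) => le le'.
have /card_gt0P[x /setIP[xa xB]] : 0 < #|avail u :&: B| by lia.
by exists x.
Qed.

(** In units of #|K|, and up to terms linear in n, the overlap of [miss u] and
    [miss b] is about 1/2 for vertices u on the side of b and 0 on the other
    side; the threshold is 1/4, and n + 6 is slack that keeps two adjacent
    vertices from both exceeding it. *)
Definition near b u := #|K| + n + 6 < 4 * #|miss u :&: miss b|.

(** [miss q] is almost disjoint from both [miss p] and [miss r]. All three
    contain nearly half of K or more, so the latter two nearly coincide. *)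
Lemma near_of_path p q r :
    ~~ small p -> ~~ small q -> ~~ small r -> edge p q -> edge q r -> near r p.
Proof.
move=> /large_card lp /large_card lq /large_card lr pq qr.
have pqI := card_missI pq; have qrI := card_missI qr.
have [+ _] := leq_card_setU (miss p :&: miss q) (miss q :&: miss r).
have -> : miss p :&: miss q :|: miss q :&: miss r
        = (miss p :|: miss r) :&: miss q.
  by rewrite setIUl [miss q :&: _]setIC.
have := cardsUI (miss p :|: miss r) (miss q).
have := cardsUI (miss p) (miss r).
have : #|miss p :|: miss r :|: miss q| <= #|K|.
  by rewrite subset_leq_card // !subUset !miss_sub.
rewrite /near; lia.
Qed.

(** If both ends were near b, two large parts of [miss b] would be almost
    disjoint. If neither were, no edge could join uw to ab: such an edge
    would give a path of length two from b to u or w. *)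
Lemma near_two_sided a b u w :
    ~~ small a -> ~~ small b -> edge a b ->
    ~~ small u -> ~~ small w -> edge u w -> near b u != near b w.
Proof.
move=> la lb ab lu lw uw; have wu : edge w u by rewrite edge_sym.
case nu: (near b u); case nw: (near b w) => //; exfalso.
  have := cardsUI (miss u :&: miss b) (miss w :&: miss b).
  have : #|miss u :&: miss b :|: miss w :&: miss b| <= #|miss b|.
    by rewrite subset_leq_card // subUset !subsetIr.
  have : #|miss u :&: miss b :&: (miss w :&: miss b)| <= #|miss u :&: miss w|.
    by rewrite subset_leq_card // setISS ?subsetIl.
  have := card_missI uw; have := card_miss_edge ab; move/large_card: la.
  move: nu nw; rewrite /near; lia.
apply: (no_two_K2 no2K2 uw ab); apply/negP => e.
- by rewrite (near_of_path lu la lb) in nu.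
- by rewrite (near_of_path lw lu lb) in nw.
- by rewrite (near_of_path lw la lb) in nw.
- by rewrite (near_of_path lu lw lb) in nu.
Qed.

Lemma avail_side a b u w :
    ~~ small a -> ~~ small b -> edge a b ->
    ~~ small u -> ~~ small w -> edge u w ->
  exists2 x, x \in avail u & (x \in miss b) = near b u.
Proof.
move=> la lb ab lu lw uw; case nu: (near b u).
  by apply: (avail_meets lu lw uw); move: nu; rewrite /near; lia.
have [|x xa xb] := avail_meets (B := ~: miss b) lu lw uw.
  move: nu; rewrite /near -setDE; have := cardsID (miss b) (miss u).
  by move/large_card: lu; lia.
by exists x => //; move: xb; rewrite inE => /negbTE.
Qed.

(** Only vertices with a large neighbour choose their side of [miss b]; the
    others take any available colour. *)
Lemma large_colouring : exists g : G -> G,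
  (forall u, ~~ small u -> g u \in avail u) /\
  (forall u v, ~~ small u -> ~~ small v -> edge u v -> g u != g v).
Proof.
pose any u := odflt u [pick x in avail u].
have anyP u : ~~ small u -> any u \in avail u.
  move=> /large_card lu; have /set0Pn[x xa] : avail u != set0.
    by apply: avail_neq0; lia.
  by rewrite /any; case: pickP => // /(_ x); rewrite xa.
pose large_edge (e : G * G) := [&& ~~ small e.1, ~~ small e.2 & edge e.1 e.2].
case: (pickP large_edge) => [[a b] /and3P[/= la lb ab]|none]; last first.
  exists any; split=> // u v lu lv uv.
  by have := none (u, v); rewrite /large_edge /= lu lv uv.
pose g u := odflt (any u) [pick x in avail u | (x \in miss b) == near b u].
have g_avail u : ~~ small u -> g u \in avail u.
  by rewrite /g; case: pickP => [x /andP[]|_ /anyP].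
have g_side u w : ~~ small u -> ~~ small w -> edge u w ->
    (g u \in miss b) = near b u.
  move=> lu lw uw; rewrite /g; case: pickP => [x /andP[_ /eqP]|] //.
  have [x xa xb] := avail_side la lb ab lu lw uw.
  by move/(_ x); rewrite xa xb eqxx.
exists g; split=> // u v lu lv uv.
have := near_two_sided la lb ab lu lv uv.
rewrite -(g_side u v) // -(g_side v u) //; last by rewrite edge_sym.
by apply: contra => /eqP->.
Qed.

Lemma chi_le_clique : chi G <= #|K|.
Proof.
have [g [g_avail g_proper]] := large_colouring.
pose c u := if small u then miss_elt u else g u.
have large_small u v : ~~ small u -> small v -> edge u v -> g u != miss_elt v.
  move=> /g_avail; rewrite inE => /andP[_ nb] sv uv; apply: contraNneq nb => ->.
  by apply/blockedP; exists v.
apply: (chi_le_card (c := c)) => [u|u v uv]; rewrite /c.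
  case: ifPn => [_|/g_avail]; first exact: subsetP (miss_sub u) _ (miss_eltP u).
  by rewrite inE => /andP[/(subsetP (miss_sub u))].
case: ifPn => su; case: ifPn => sv.
- exact: small_miss_elt_proper.
- by rewrite eq_sym large_small // edge_sym.
- exact: large_small.
- exact: g_proper.
Qed.

End MaximumClique.

(** * The bound on the chromatic number *)

Lemma omega_clique (G : sgraph) :
  exists2 K : {set G}, clique K & omega G = #|K|.
Proof.
have clique0 : clique (set0 : {set G}) by apply/cliqueP => x; rewrite inE.
have [|K Kcl eqK] := @eq_bigmax_cond _ (@clique G) (fun A => #|A|).
  by apply/card_gt0P; exists set0.
by exists K.
Qed.

Theorem theorem7 (n : nat) (n_gt0 : 0 < n) :
  near_optimal_colourable
    (free2 two_K2 (join (path_graph 4) (complete_graph n))).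
Proof.
exists ((10 * n + 20) * (10 * n + 20)) => G [no2K2 noP4K].
have [K Kcl omegaK] := omega_clique G.
have Kmax (A : {set G}) : clique A -> #|A| <= #|K|.
  by rewrite -omegaK; apply: leq_bigmax_cond.
rewrite leq_max omegaK; apply/orP.
have [large|small] := leqP (10 * n + 20) #|K|; [right | left].
  exact: (chi_le_clique no2K2 noP4K).
by apply: leq_trans (chi_le_square no2K2 Kcl Kmax) _; rewrite leq_mul // ltnW.
Qed.
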